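(* Let $G$ be a group and $X$ a $\mathbf 0$-distributive bounded $G$-lattice. For every $n\in\mathbb N$, $$\inf_{A\in\mathbf 1/n}\sum_{a\in A}p_X(a)\ge\frac{n}{s_{-1}(n)}\ge\frac1{s_{-\infty}(n)},\qquad \partial^np_X(\mathbf 1)\le 1-\frac{n}{s_{-1}(n)}\le 1-\frac1{s_{-\infty}(n)},$$ and $$\inf_{A\in\mathbf 1/n}\max_{a\in A}p_X(a)\ge\frac1{s_{-\infty}(n)},\qquad \sup_{A\in\mathbf 1/n}\min_{a\in A}\operatorname{lar}(\Delta(a))\le s_{-\infty}(n).$$
   Context: Lattices: set $X$ with commutative, associative, idempotent $\vee,\wedge$ satisfying absorption, ordered by $x\le y$ iff $x\wedge y=x$; bounded: least/greatest elements $\mathbf 0\ne\mathbf 1$; $\mathbf 0$-distributive: $x\wedge(y\vee z)=(x\wedge y)\vee(x\wedge z)$ whenever $x\wedge y=\mathbf 0$. A $G$-lattice has an action of $G$ by lattice automorphisms. $\Delta(a)=\{g\in G:ga\wedge a\ne\mathbf 0\}$; for nonempty $D\subset G$, $\operatorname{lar}(D)=\min\{|F|:F\subset G,\ G=FD\}$, $\operatorname{lar}(\emptyset)$ is the smallest infinite cardinal $>|G|$; $p_X(a)=1/\operatorname{lar}(\Delta(a))$ if $0<\operatorname{lar}(\Delta(a))<\omega$, else $0$. $\mathbf 1/n=\{A\subset X:|A|\le n,\ \bigvee A=\mathbf 1\}$ and $\partial^n\mu(\mathbf 1)=\sup_{A\in\mathbf 1/n}(\mu(\mathbf 1)-\sum_{a\in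 A}\mu(a))$. Combinatorial part: identify $n=\{0,\dots,n-1\}$; $\omega^n$ = functions $n\to\omega$ with pointwise addition; $1_i$ is the indicator of $\{i\}$; ${\downarrow}\hbar=\{g\in\omega^n: g(i)<\hbar(i)\ \forall i\}$; sumsets $\sum_{i}A_i=\{\sum_i a_i:a_i\in A_i\}$. For $\hbar\in\omega^n$: $\hbar^{[0]}(i)=\hbar^{\{0\}}(i)=\{1_i\}$, $\hbar^{\{m+1\}}(i)=\{x-x(i)1_i:x\in({\downarrow}\hbar)\cap\sum_{j\in n}\hbar^{[m]}(j)\}$, $\hbar^{[m+1]}(i)=\hbar^{\{m+1\}}(i)\cup\hbar^{[m]}(i)$, $\hbar^{[\omega]}(i)=\bigcup_m\hbar^{\{m\}}(i)$; $\hbar$ is $0$-generating if the zero function lies in $\bigcup_i\hbar^{[\omega]}(i)$. $s_{-\infty}(n)=\sup\{\min_{i}\hbar(i):\hbar\in\omega^n \text{ not $0$-generating}\}$ and $s_{-1}(n)=\sup\{M_{-1}(\hbar):\hbar\in\omega^n\text{ not $0$-generating}\}$, where $M_{-1}(\hbar)=n\big/\sum_{i\in n}\frac1{\hbar(i)}$ (taken to be $0$ if some $\hbar(i)=0$). *)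

(* Defs.v *)
From HB Require Import structures.
From mathcomp Require Import all_boot all_order all_algebra.
From mathcomp Require Import finmap.
From mathcomp Require Import all_classical all_reals.
From mathcomp Require Import ereal.

Set Implicit Arguments.
Unset Strict Implicit.
Unset Printing Implicit Defensive.

Import Order.TTheory GRing.Theory Num.Theory.

Local Open Scope classical_set_scope.
Local Open Scope ring_scope.

(* Bijectivity of the shifts follows from the action laws, so each [act g] is
   a lattice automorphism. *)
Definition is_lattice_action (G : groupType) (disp : Order.disp_t)
    (X : latticeType disp) (act : G -> X -> X) : Prop :=
  [/\ forall x, act 1%g x = x,
      forall g h x, act (g * h)%g x = act g (act h x),
      forall g x y, act g (x `&` y)%O = (act g x `&` act g y)%O
    & forall g x y, act g (x `|` y)%O = (act g x `|` act g y)%O].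

Definition zero_distributive (disp : Order.disp_t) (X : tbLatticeType disp) : Prop :=
  forall x y z : X, (x `&` y = \bot)%O ->
    (x `&` (y `|` z) = (x `&` y) `|` (x `&` z))%O.

Definition Delta (G : groupType) (disp : Order.disp_t) (X : tbLatticeType disp)
    (act : G -> X -> X) (a : X) : set G :=
  [set g | (act g a `&` a)%O <> \bot%O].

(* The cardinal [lar D], with all infinite cardinals identified with [+oo].
   For empty [D] no [F] qualifies and the infimum is [+oo] as well. The
   identification loses nothing here: [p_] only depends on finite values, and
   [lar] is otherwise only bounded above by [s_minfty], which is finite by
   [s_minfty_lty] below. *)
Definition lar (R : realType) (G : groupType) (D : set G) : \bar R :=
  ereal_inf [set (k%:R)%:E | k in
    [set k : nat | exists F : set G,
       (F #= `I_k)%card /\ [set (f * d)%g | f in F & d in D] = setT]].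

Definition p_ (R : realType) (G : groupType) (disp : Order.disp_t)
    (X : tbLatticeType disp) (act : G -> X -> X) (a : X) : R :=
  let l := lar R (Delta act a) in
  if ((0 < l) && (l < +oo))%E then (fine l)^-1 else 0.

(* The family 1/n. *)
Definition covers (disp : Order.disp_t) (X : tbLatticeType disp) (n : nat) :
    set {fset X} :=
  [set A : {fset X} | (#|` A| <= n)%N /\ (\join_(a <- A) a = \top)%O].
Arguments covers {disp} X n.

Definition boundary (R : realType) (disp : Order.disp_t) (X : tbLatticeType disp)
    (n : nat) (mu : X -> R) : \bar R :=
  ereal_sup [set (mu \top%O - \sum_(a <- A) mu a)%:E | A in covers X n].

Section ZeroGenerating.
Variable n : nat.
Local Notation omega_n := {ffun 'I_n -> nat}.
Implicit Types (h x g : omega_n) (A : 'I_n -> set omega_n).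

Definition ind (i : 'I_n) : omega_n := [ffun k => nat_of_bool (k == i)].

Definition down h : set omega_n := [set g : omega_n | forall i, (g i < h i)%N].

Definition sumset A : set omega_n :=
  [set \sum_(j < n) a j | a in [set a : 'I_n -> omega_n | forall j, A j (a j)]].

(* x - x(i) 1_i *)
Definition kill (i : 'I_n) x : omega_n :=
  [ffun k => (x k - x i * ind i k)%N].

Definition step h A (i : 'I_n) : set omega_n :=
  [set kill i x | x in down h `&` sumset A].

Fixpoint brack h (m : nat) (i : 'I_n) : set omega_n :=
  if m is m'.+1 then step h (brack h m') i `|` brack h m' i else [set ind i].

Definition brace h (m : nat) (i : 'I_n) : set omega_n :=
  if m is m'.+1 then step h (brack h m') i else [set ind i].

Definition brack_omega h (i : 'I_n) : set omega_n := \bigcup_m brace h m i.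

Definition zero_generating h : Prop := (\bigcup_i brack_omega h i) 0.

End ZeroGenerating.

(* Meant for [0 < n]; the unit [+oo] of [min] is never reached then. *)
Definition min_val (R : realType) (n : nat) (h : {ffun 'I_n -> nat}) : \bar R :=
  (\big[Order.min/+oo]_(i < n) ((h i)%:R)%:E)%E.

Definition M_m1 (R : realType) (n : nat) (h : {ffun 'I_n -> nat}) : R :=
  if [exists i, h i == 0%N] then 0 else n%:R / \sum_(i < n) ((h i)%:R)^-1.

Definition s_minfty (R : realType) (n : nat) : \bar R :=
  ereal_sup [set min_val R h | h in [set h : {ffun 'I_n -> nat} | ~ zero_generating h]].

Definition s_m1 (R : realType) (n : nat) : \bar R :=
  ereal_sup [set (M_m1 R h)%:E | h in [set h : {ffun 'I_n -> nat} | ~ zero_generating h]].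

Lemma brack_sub_omega n (h : {ffun 'I_n -> nat}) m i :
  brack h m i `<=` brack_omega h i.
Proof.
elim: m => [|m IH] x /=; first by move=> Hx; exists 0%N.
by case=> [Hx|/IH//]; exists m.+1.
Qed.

Lemma brack_ind n (h : {ffun 'I_n -> nat}) m i : brack h m i (ind i).
Proof. by elim: m => [|m IH] //=; right. Qed.

Lemma brack_vanish n (h : {ffun 'I_n -> nat}) (k : nat) :
  (forall i, (n.+1 ^ k <= h i)%N) ->
  forall (S : {set 'I_n}) i, (#|S| <= k)%N -> i \in S ->
  exists x, [/\ brack h k i x, forall j, j \in S -> x j = 0%N
                & forall j, (x j <= n.+1 ^ k)%N].
Proof.
elim: k => [|k IH] hk S i Sk iS.
  by move: Sk; rewrite leqn0 => /eqP/cards0_eq S0; rewrite S0 finset.in_set0 in iS.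
have hk' l : (n.+1 ^ k <= h l)%N by rewrite (leq_trans _ (hk l))// leq_pexp2l.
have /choice[a aP] : forall j, exists x, [/\ brack h k j x,
    forall l, l \in S :\ i -> x l = 0%N & forall l, (x l <= n.+1 ^ k)%N].
  move=> j; have [jS|jS] := boolP (j \in S :\ i).
    by apply: IH => //; move: Sk; rewrite (cardsD1 i) iS.
  exists (ind j); split; first exact: brack_ind.
    move=> l lS; rewrite ffunE; case: eqP => // lj.
    by rewrite -lj lS in jS.
  by move=> l; rewrite ffunE (leq_trans (leq_b1 _))// expn_gt0.
set y : {ffun 'I_n -> nat} := \sum_(j < n) a j.
have yE l : y l = (\sum_(j < n) a j l)%N by rewrite /y sum_ffunE.
have ylt l : (y l < n.+1 ^ k.+1)%N.
  rewrite yE; apply: (@leq_ltn_trans (n * n.+1 ^ k)%N).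
    rewrite -[X in (_ <= X * _)%N]card_ord -sum_nat_const.
    by apply: leq_sum => j _; case: (aP j).
  by rewrite expnS ltn_pmul2r ?expn_gt0.
exists (kill i y); split.
- left; exists y => //; split; first by move=> l; exact: leq_trans (ylt l) (hk l).
  by exists a => // j; case: (aP j).
- move=> j jS; rewrite !ffunE; have [->|ji] := eqVneq j i.
    by rewrite muln1 subnn.
  rewrite muln0 subn0 yE big1// => l _; case: (aP l) => _ -> //.
  by rewrite !inE ji.
- by move=> j; rewrite ffunE (leq_trans (leq_subr _ _))// ltnW.
Qed.

Lemma s_minfty_lty (R : realType) n : (0 < n)%N -> (s_minfty R n < +oo)%E.
Proof.
move=> n0; apply: (@le_lt_trans _ _ ((n.+1 ^ n)%:R)%:E); last exact: ltry.
apply: ge_ereal_sup => _ [h hN <-].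
have [i hi] : exists i, (h i < n.+1 ^ n)%N.
  apply: contrapT => hlt; apply: hN; pose i0 := Ordinal n0.
  have hge i : (n.+1 ^ n <= h i)%N.
    by rewrite leqNgt; apply/negP => ?; apply: hlt; exists i.
  have [||x [xb x0 _]] := @brack_vanish n h n hge [set: 'I_n]%SET i0.
  - by rewrite cardsT card_ord.
  - by rewrite finset.in_setT.
  exists i0 => //; apply: (@brack_sub_omega _ _ n).
  suff <- : x = 0 by [].
  by apply/ffunP => j; rewrite x0 ?finset.in_setT// ffunE.
apply: (@le_trans _ _ ((h i)%:R)%:E); last by rewrite lee_fin ler_nat ltnW.
by rewrite /min_val (bigD1 i)//= ge_min lexx.
Qed.

(* Main.v *)
Require Import Defs.
From HB Require Import structures.
From mathcomp Require Import all_boot all_order all_algebra.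
From mathcomp Require Import finmap.
From mathcomp Require Import all_classical all_reals.
From mathcomp Require Import ereal.

Set Implicit Arguments.
Unset Strict Implicit.
Unset Printing Implicit Defensive.

Import Order.TTheory GRing.Theory Num.Theory.

Local Open Scope classical_set_scope.
Local Open Scope ring_scope.
Local Open Scope ereal_scope.

(* Let [a] be a cover of [\top] and [h j <= lar (Delta (a j))] for all [j]. By
   induction on [m], every [x] in [brack h m i] comes with a cover of [a i] by
   translates of the [a j] using [x j] translates of [a j]: summing up covers
   of all the [a j] gives a cover of [\top], and if it uses fewer than [h i]
   translates of [a i], some further translate of [a i] is disjoint from all of
   them, so that by 0-distributivity it is covered by the others. If [0] were
   reached, then [a i = \bot] while finitely many translates of [a i] cover
   [\top], which is absurd. Hence [h] is not 0-generating, and the bounds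
   follow by choosing [h] constant or [h j] close to [lar (Delta (a j))]. *)

(** * Largeness of subsets of a group *)

Section Largeness.
Variables (R : realType) (G : groupType).
Implicit Types D : set G.

(** Otherwise the set of entries of [s] would be an admissible [F]; repetitions in [s] only make it
    smaller. *)
Lemma lar_seq_lt D (s : seq G) :
  (size s)%:R%:E < lar R D -> exists g, forall f, f \in s -> ~ D (f^-1 * g)%g.
Proof.
move=> sD; apply: contrapT => no_g; suff: lar R D <= (size s)%:R%:E.
  by rewrite leNgt sD.
apply: (@le_trans _ _ (#|` [fset x in s]%fset|)%:R%:E); last first.
  by rewrite lee_fin ler_nat card_fseq size_undup.
apply: ereal_inf_lbound; exists #|` [fset x in s]%fset| => //=.
exists [set` [fset x in s]%fset]; split; first exact/card_eq_fsetP.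
apply/seteqP; split=> // g _; apply: contrapT => gD; apply: no_g.
exists g => f fs Dg; apply: gD; exists f; first by rewrite /= inE.
by exists (f^-1 * g)%g => //; rewrite mulVKg.
Qed.

Lemma lar_cases D : lar R D = +oo \/ exists2 k, (0 < k)%N & lar R D = k%:R%:E.
Proof.
rewrite /lar; set S := [set k : nat | _].
have [-> | /set0P[k0 Sk0]] := eqVneq S set0.
  by left; rewrite image_set0 ereal_inf0.
right; have exS : exists k, `[< S k >] by exists k0; apply/asboolP.
case: (ex_minnP exS) => k /asboolP Sk kmin; exists k.
  (* For [k = 0] the set [F] is empty, so its product with [D] misses the unit. *)
  case: k Sk {kmin} => // -[F [F0 FD]].
  move: F0; rewrite II0 card_eq0 => /eqP F0.
  have : [set: G] 1%g by [].
  by rewrite -FD F0 => -[].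
apply/eqP; rewrite eq_le ereal_inf_lbound/=; last by exists k.
apply: le_ereal_inf_tmp => _ [j Sj <-]; rewrite lee_fin ler_nat.
by apply: kmin; apply/asboolP.
Qed.

Lemma lar_ge1 D : 1 <= lar R D.
Proof.
case: (lar_cases D) => [->|[k k0 ->]]; first exact: leey.
by rewrite lee_fin ler1n.
Qed.

Lemma lar_ge0 D : 0 <= lar R D.
Proof. exact: le_trans (lar_ge1 D). Qed.

End Largeness.

(** * Translates in a lattice with a group action *)

Section Action.
Variables (G : groupType) (disp : Order.disp_t) (X : tbLatticeType disp).
Variable act : G -> X -> X.
Hypothesis X_action : is_lattice_action act.

Let act1 x : act 1%g x = x. Proof. by case: X_action. Qed.
Let actM g h x : act (g * h)%g x = act g (act h x).
Proof. by case: X_action. Qed.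

Lemma act_bot g : act g \bot%O = \bot%O.
Proof.
case: X_action => _ _ actI _.
have := actI g \bot%O (act g^-1%g \bot%O).
by rewrite meet0x -actM mulgV act1 meetx0.
Qed.

Lemma act_le g x y : (x <= y)%O -> (act g x <= act g y)%O.
Proof.
case: X_action => _ _ actI _ /meet_idPl xy.
by apply/meet_idPl; rewrite -actI xy.
Qed.

Lemma act_join g T (r : seq T) (P : pred T) (F : T -> X) :
  act g (\join_(t <- r | P t) F t)%O = (\join_(t <- r | P t) act g (F t))%O.
Proof.
case: X_action => _ _ _ actU.
by apply: (big_morph (act g)); [exact: actU | exact: act_bot].
Qed.

(** The map [act f] fixes [\bot] and carries the meet of the [f^-1 * g]-translate of [a] with [a] to
    the meet on the right. *)
Lemma notin_Delta a f g :
  ~ Delta act a (f^-1 * g)%g -> (act g a `&` act f a)%O = \bot%O.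
Proof.
case: X_action => _ _ actI _ /contrapT /(congr1 (act f)).
by rewrite actI -actM mulVKg act_bot.
Qed.

End Action.

Lemma zero_distr_join (disp : Order.disp_t) (X : tbLatticeType disp)
    T (r : seq T) (P : pred T) (F : T -> X) (x : X) :
  zero_distributive X ->
  (forall t, P t -> (x `&` F t)%O = \bot%O) ->
  (x `&` \join_(t <- r | P t) F t)%O = \bot%O.
Proof.
move=> X0 xF; elim/big_rec: _ => [|t y Pt xy]; first by rewrite meetx0.
by rewrite X0 ?xF// xy joinx0.
Qed.

(** * Covers by translates and 0-generation *)

Section Covering.
Variables (R : realType) (G : groupType) (disp : Order.disp_t).
Variables (X : tbLatticeType disp) (act : G -> X -> X) (n : nat).
Variable a : 'I_n -> X.
Hypotheses (X_nontrivial : (\bot%O : X) <> \top%O).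
Hypotheses (X_action : is_lattice_action act) (X_0distr : zero_distributive X).
Hypothesis a_cover : (\join_(i < n) a i = \top)%O.

(* Translates are counted with repetitions, so that counts add up exactly. *)
Definition covered_by (y : X) (x : {ffun 'I_n -> nat}) : Prop :=
  exists s : seq (G * 'I_n),
    (forall j, count (fun p => p.2 == j) s = x j) /\
    (y <= \join_(p <- s) act p.1 (a p.2))%O.

Lemma covered_by_ind i : covered_by (a i) (ind i).
Proof.
exists [:: (1%g, i)]; split=> [j|]; first by rewrite /= addn0 ffunE eq_sym.
by rewrite big_seq1; case: X_action => ->.
Qed.

(** Concatenating one cover for each [a i] adds up the counts and covers the join of all [a i]. *)
Lemma covered_by_sumset (B : 'I_n -> set {ffun 'I_n -> nat}) x :
  (forall i y, B i y -> covered_by (a i) y) -> sumset B x ->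
  covered_by \top%O x.
Proof.
move=> Bcov [b bB <-]; have /choice[s sP] i := Bcov _ _ (bB i).
exists (\big[cat/[::]]_(i < n) s i); split=> [j|].
  rewrite sum_ffunE (big_morph _ (count_cat _) erefl).
  by apply: eq_bigr => i _; case: (sP i).
rewrite (big_morph (fun t => (\join_(p <- t) act p.1 (a p.2))%O)
  (fun t u => big_cat _ t u _ _) (big_nil _ _ _ _)) -a_cover.
by apply/joinsP => i _; apply: (joins_min (j := i)) => //; case: (sP i).
Qed.

(* A translate [act g (a i)] disjoint from the translates of [a i] in the
   cover of [\top] lies, by 0-distributivity, below the remaining ones. *)
Lemma covered_by_kill i (x : {ffun 'I_n -> nat}) :
  (x i)%:R%:E < lar R (Delta act (a i)) -> covered_by \top%O x ->
  covered_by (a i) (kill i x).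
Proof.
move=> xi [s [sx sT]].
have [] := @lar_seq_lt R G (Delta act (a i)) [seq p.1 | p <- s & p.2 == i].
  by rewrite size_map size_filter sx.
(* The translates with index other than [i] cover [act g (a i)]; applying [g^-1] to them gives a
   cover of [a i] with the same indices, hence the same counts. *)
move=> g gP; exists [seq ((g^-1 * p.1)%g, p.2) | p <- s & p.2 != i].
split=> [j|].
  rewrite count_map count_filter !ffunE; have [->|ji] := eqVneq j i.
    rewrite muln1 subnn (eq_count (a2 := pred0)) ?count_pred0// => p /=.
    exact: andbN.
  rewrite muln0 subn0 -sx; apply: eq_count => p /=.
  by case: eqP => // ->.
have [act1 actM _ _] := X_action.
have actV y : act g^-1%g (act g y) = y by rewrite -actM mulVg act1.
rewrite big_map big_filter -[a i]actV.
under eq_bigr do rewrite /= actM.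
rewrite -(act_join X_action); apply: (act_le X_action).
have disj :
  (act g (a i) `&` \join_(p <- s | p.2 == i) act p.1 (a p.2))%O = \bot%O.
  rewrite big_seq_cond; apply: zero_distr_join => // p /andP[ps /eqP pi].
  rewrite pi; apply: (notin_Delta X_action); apply: gP.
  by apply/mapP; exists p; rewrite // mem_filter pi eqxx.
have := le_trans (lex1 (act g (a i))) sT.
by rewrite (bigID (fun p => p.2 == i))/= leEmeet X_0distr// disj join0x -leEmeet.
Qed.

Lemma covered_by_brack (h : {ffun 'I_n -> nat}) m i x :
  (forall j, (h j)%:R%:E <= lar R (Delta act (a j))) ->
  brack h m i x -> covered_by (a i) x.
Proof.
move=> hlar; elim: m i x => [|m IH] i x /=.
  by move=> ->; exact: covered_by_ind.
case=> [|/IH//] [y [yh yB] <-]; apply: covered_by_kill.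
  by apply: lt_le_trans (hlar i); rewrite lte_fin ltr_nat; exact: yh.
exact: covered_by_sumset IH yB.
Qed.

Lemma covered_by0 y : covered_by y [ffun=> 0%N] -> y = \bot%O.
Proof.
move=> [[|p s] [s0 ys]]; first by move: ys; rewrite big_nil lex0 => /eqP.
by have := s0 p.2; rewrite /= eqxx ffunE.
Qed.

Lemma lar_not_zero_generating (h : {ffun 'I_n -> nat}) :
  (forall j, (h j)%:R%:E <= lar R (Delta act (a j))) -> ~ zero_generating h.
Proof.
move=> hlar [i _ [[|m] _ /=]].
  (* At level 0 the only element is [ind i], which is nonzero at [i]. *)
  by move=> /ffunP/(_ i); rewrite !ffunE eqxx.
move=> [y [yh yB] yi0].
have yT : covered_by \top%O y.
  by apply: covered_by_sumset yB => j x; exact: covered_by_brack.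
(* Since [kill i y] is zero, [a i] is covered by an empty list of translates. *)
have ai0 : a i = \bot%O.
  apply: covered_by0; rewrite [X in covered_by _ X](_ : _ = kill i y).
    apply: covered_by_kill yT; apply: lt_le_trans (hlar i).
    by rewrite lte_fin ltr_nat; exact: yh.
  by rewrite yi0; apply/ffunP => j; rewrite !ffunE.
(* As [y] vanishes off [i], this cover of [\top] consists of translates of [a i = \bot] only. *)
have [s [sy sT]] := yT; apply: X_nontrivial; apply/eqP.
rewrite -le1x (le_trans sT)//; apply/joinsP_seq => p ps _.
have [->|pi] := eqVneq p.2 i; first by rewrite ai0 (act_bot X_action).
have : (0 < count (fun q => q.2 == p.2) s)%N.
  by rewrite -has_count; apply/hasP; exists p.
by move/ffunP: yi0 => /(_ p.2); rewrite sy !ffunE (negPf pi) muln0 subn0 => ->.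
Qed.
End Covering.

(** Serves to replace a cover with at most [n] members by a family indexed by ['I_n], padded with a
    neutral [x0]. *)
Lemma big_nth_pad (S T : Type) (idx : S) (op : Monoid.law idx) (x0 : T)
    (s : seq T) (n : nat) (F : T -> S) :
  (size s <= n)%N -> F x0 = idx ->
  \big[op/idx]_(i < n) F (nth x0 s i) = \big[op/idx]_(x <- s) F x.
Proof.
move=> sn Fx0; rewrite (big_nth x0) -(big_mkord xpredT (fun i => F (nth x0 s i))).
rewrite (big_cat_nat (n := size s))//= [X in op _ X]big_nat_cond.
rewrite [X in op _ X]big1 ?Monoid.mulm1// => i /andP[/andP[si _] _].
by rewrite nth_default.
Qed.

(** * Largeness and the values of [p_] *)

Section Mass.
Variables (R : realType) (G : groupType) (disp : Order.disp_t).
Variables (X : tbLatticeType disp) (act : G -> X -> X).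

(** Here [Delta] is empty. Hence padding a cover with [\bot] adds nothing to the sum of [p_] and
    respects every lower bound on [lar]. *)
Lemma lar_Delta_bot : lar R (Delta act \bot%O) = +oo.
Proof.
rewrite /lar (_ : [set k : nat | _] = set0) ?image_set0 ?ereal_inf0//.
apply/seteqP; split=> // k [F [_ FD]].
have : [set: G] 1%g by [].
by rewrite -FD => -[f _ [d]]; rewrite /Delta /= meetx0.
Qed.

(** As [+oo] has inverse [0] and [lar] is never [0], the case distinction in [p_] is absorbed by the
    extended inverse. *)
Lemma p_EFin (a : X) : (p_ R act a)%:E = (lar R (Delta act a))^-1.
Proof.
rewrite /p_; have [->|[k k0 ->]] := lar_cases R (Delta act a).
  by rewrite ltxx andbF invey.
by rewrite lte_fin ltr0n k0 ltry /= inver pnatr_eq0 gtn_eqF.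
Qed.

Lemma p_le1 (a : X) : (p_ R act a <= 1)%R.
Proof.
by rewrite -lee_fin p_EFin -[leRHS]inve1 lee_pV2 ?lar_ge1 ?inE ?lar_ge0//.
Qed.

Lemma p_ge0 (a : X) : (0 <= p_ R act a)%R.
Proof. by rewrite -lee_fin p_EFin inve_ge0 lar_ge0. Qed.

(* An infinite [lar] can only be approximated by natural numbers, hence [e]. *)
Lemma nat_approx_lar (a : X) (e : R) : (0 < e)%R ->
  exists k, [/\ (0 < k)%N, k%:R%:E <= lar R (Delta act a)
              & (k%:R^-1 <= p_ R act a + e)%R].
Proof.
move=> e0; have [lary|[k k0 lark]] := lar_cases R (Delta act a).
  exists (Num.Def.archi_bound e^-1).+1; split=> //; first by rewrite lary leey.
  set N := Num.Def.archi_bound _.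
  have eN : (e^-1 <= N.+1%:R)%R.
    have /ltW/le_trans -> // : (e^-1 < N%:R)%R.
      by rewrite archi_boundP// invr_ge0 ltW.
    by rewrite ler_nat.
  by rewrite -[leLHS]add0r lerD ?p_ge0// invf_ple ?posrE.
exists k; split; rewrite ?lark// -lee_fin EFinD p_EFin lark inver.
by rewrite pnatr_eq0 gtn_eqF// leeDl// lee_fin ltW.
Qed.

End Mass.

(** * Minimum and harmonic mean *)

Section NotZeroGenerating.
Variables (R : realType) (n : nat).
Implicit Type h : {ffun 'I_n -> nat}.

Lemma min_val_cst k :
  (0 < n)%N -> min_val R ([ffun=> k] : {ffun 'I_n -> nat}) = k%:R%:E.
Proof.
move=> n0; apply/eqP; rewrite eq_le; apply/andP; split.
  by rewrite (le_trans (bigmin_le _ (Ordinal n0) _))// ffunE.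
by apply: le_bigmin => [|i _]; rewrite ?leey// ffunE.
Qed.

(** The sum of the reciprocals is at least the reciprocal of the smallest value. For [n = 0] the
    minimum is [+oo] and the hypothesis fails. *)
Lemma M_m1_le_min h (r : R) : min_val R h <= r%:E -> (M_m1 R h <= n%:R * r)%R.
Proof.
move=> hr; have [i hir] : exists i, ((h i)%:R <= r)%R.
  apply: contrapT => hN; move: hr; apply/negP; rewrite -ltNge.
  apply: lt_bigmin => [|i _]; first exact: ltry.
  by rewrite lte_fin ltNge; apply/negP => hir; apply: hN; exists i.
have r0 : (0 <= r)%R by apply: le_trans hir.
rewrite /M_m1; case: ifPn => [_|/existsPn h0]; first by rewrite mulr_ge0.
rewrite ler_wpM2l//; apply: le_trans hir; rewrite -[leRHS]invrK.
have hi0 : (0 < (h i)%:R^-1 :> R)%R by rewrite invr_gt0 ltr0n lt0n.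
rewrite lef_pV2 ?posrE//.
  by rewrite (bigD1 i)//= lerDl sumr_ge0// => j _; rewrite invr_ge0.
by rewrite (bigD1 i)//= ltr_pwDl// sumr_ge0// => j _; rewrite invr_ge0.
Qed.

End NotZeroGenerating.

Theorem theorem1p15 (R : realType) (G : groupType) (disp : Order.disp_t)
    (X : tbLatticeType disp) (act : G -> X -> X) (n : nat)
    (X_nontrivial : (\bot%O : X) <> \top%O)
    (X_action : is_lattice_action act)
    (X_0distr : zero_distributive X)
    (n_gt0 : (0 < n)%N) :
  let p : X -> R := p_ R act in
  let s1 : \bar R := s_m1 R n in
  let sinf : \bar R := s_minfty R n in
  [/\ n%:R%:E / s1 <= ereal_inf [set (\sum_(a <- A) p a)%R%:E | A in covers X n]
      /\ 1 / sinf <= n%:R%:E / s1,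
      boundary n p <= 1 - n%:R%:E / s1
      /\ 1 - n%:R%:E / s1 <= 1 - 1 / sinf,
      1 / sinf <=
        ereal_inf [set (\big[Order.max/0%R]_(a <- A) p a)%:E | A in covers X n]
    & ereal_sup [set \big[Order.min/+oo]_(a <- A) lar R (Delta act a)
                | A in covers X n] <= sinf].
Proof.
move=> p s1 sinf.
have padded A : covers X n A -> exists a : 'I_n -> X,
    [/\ forall h : {ffun 'I_n -> nat},
          (forall i, (h i)%:R%:E <= lar R (Delta act (a i))) -> ~ zero_generating h,
        (\sum_(i < n) p (a i) = \sum_(x <- A) p x)%R
      & forall c, (forall x, x \in A -> c <= lar R (Delta act x)) ->
          forall i, c <= lar R (Delta act (a i))].
  move=> [An AT]; exists (fun i : 'I_n => nth \bot%O A i); split.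
  - move=> h; apply: lar_not_zero_generating => //.
    by rewrite (big_nth_pad _ (F := id)).
  - rewrite (big_nth_pad _ (F := p))//; apply: EFin_inj.
    by rewrite /p p_EFin lar_Delta_bot invey.
  - move=> c cA i; have [iA|iA] := ltnP i (size A); first exact/cA/mem_nth.
    by rewrite nth_default// lar_Delta_bot leey.
have topA : covers X n [fset \top%O]%fset.
  by split; rewrite ?cardfs1// big_seq_fset1.
(* The constant 1 bounds both suprema below by 1, so that dividing by them is harmless. *)
pose one : {ffun 'I_n -> nat} := [ffun=> 1%N].
have one_ngen : ~ zero_generating one.
  have [a [agen _ _]] := padded _ topA.
  by apply: agen => i; rewrite ffunE lar_ge1.
have sinf1 : 1 <= sinf.
  apply: ereal_sup_ubound; exists one => //; exact: min_val_cst.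
have s11 : 1 <= s1.
  apply: ereal_sup_ubound; exists one => //.
  rewrite /M_m1; case: existsP => [[i]|_]; first by rewrite ffunE.
  under eq_bigr do rewrite ffunE invr1.
  by rewrite sumr_const card_ord divff// pnatr_eq0 gtn_eqF.
have sinfy : sinf < +oo by exact: s_minfty_lty.
have [r rE] : exists r, sinf = r%:E.
  by case: sinf sinf1 sinfy => // r; exists r.
have r1 : (1 <= r)%R by rewrite -lee_fin -rE.
(* This yields both the finiteness of [s1] and the comparison of the two bounds. *)
have s1r : s1 <= (n%:R * r)%:E.
  apply: ge_ereal_sup => _ [h hN <-]; rewrite lee_fin M_m1_le_min// -rE.
  by apply: ereal_sup_ubound; exists h.
have [t tE] : exists t, s1 = t%:E.
  by case: s1 s11 s1r => // t; exists t.
have t1 : (1 <= t)%R by rewrite -lee_fin -tE.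
have [r0 t0] : (0 < r)%R /\ (0 < t)%R by split; exact: lt_le_trans ltr01 _.
have nt : n%:R%:E / s1 = (n%:R / t)%:E by rewrite tE inver gt_eqF.
have r_inv : 1 / sinf = (r^-1)%:E by rewrite mul1e rE inver gt_eqF.
have rt : (r^-1 <= n%:R / t)%R.
  rewrite ler_pdivlMr// mulrC ler_pdivrMr//.
  by rewrite -lee_fin -tE.
(* With [k i] such that [(k i)^-1 <= p (a i) + e / n], the bound [t] on the harmonic mean gives
   [n / t <= \sum (k i)^-1 <= \sum p + e]. *)
have sum_p A : covers X n A -> (n%:R / t <= \sum_(a <- A) p a)%R.
  move=> /padded[a [agen <- _]]; apply/ler_addgt0Pr => e e0.
  have en0 : (0 < e / n%:R)%R by rewrite divr_gt0// ltr0n.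
  have /choice[k kP] i := nat_approx_lar act (a i) en0.
  pose h : {ffun 'I_n -> nat} := [ffun i => k i].
  have h_ngen : ~ zero_generating h.
    by apply: agen => i; rewrite ffunE; case: (kP i).
  have : (M_m1 R h <= t)%R.
    by rewrite -lee_fin -tE; apply: ereal_sup_ubound; exists h.
  rewrite /M_m1; case: existsP => [[i]|_ ht].
    by rewrite ffunE; case: (kP i) => /lt0n_neq0/negPf ->.
  apply: (@le_trans _ _ (\sum_(i < n) (h i)%:R^-1)%R).
    rewrite ler_pdivrMr// mulrC -ler_pdivrMr//.
    rewrite (bigD1 (Ordinal n_gt0))//= ltr_pwDl ?sumr_ge0//.
    by rewrite invr_gt0 ltr0n ffunE; case: (kP (Ordinal n_gt0)).
  have -> : (e = \sum_(i < n) e / n%:R)%R.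
    by rewrite sumr_const card_ord -[RHS]mulr_natr divfK// pnatr_eq0 gtn_eqF.
  by rewrite -big_split; apply: ler_sum => i _; rewrite ffunE; case: (kP i).
have min_lar A : covers X n A ->
    exists2 a, a \in A & lar R (Delta act a) <= sinf.
  move=> /padded[a [agen _ alar]]; apply: contrapT => Ninf.
  (* If every [lar] exceeded [r], each, being an integer or [+oo], would be at least [truncn r + 1];
     this constant would then be a non-0-generating function with minimum above [r]. *)
  have : ((Num.truncn r).+1)%:R%:E <= sinf.
    apply: ereal_sup_ubound; exists [ffun=> (Num.truncn r).+1].
      apply: agen => i; rewrite ffunE; apply: alar => x xA.
      have : sinf < lar R (Delta act x).
        by rewrite ltNge; apply/negP => xinf; apply: Ninf; exists x.
      have [->|[k _ ->]] := lar_cases R (Delta act x); first by rewrite leey.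
      by rewrite rE lte_fin lee_fin ler_nat truncn_lt_nat// ltW.
    exact: min_val_cst.
  rewrite rE lee_fin => /(lt_le_trans (truncnS_gt r)); by rewrite ltxx.
split.
- split; last by rewrite nt r_inv lee_fin.
  by rewrite nt; apply: le_ereal_inf_tmp => _ [A /sum_p Ap <-].
- rewrite nt r_inv; split; last by rewrite lee_fin lerD2l lerN2.
  apply: ge_ereal_sup => _ [A /sum_p Ap <-].
  by rewrite lee_fin lerB// p_le1.
- apply: le_ereal_inf_tmp => _ [A /min_lar[a aA asinf] <-].
  (* The member of smallest [lar] need not be known: any [a] with [lar] at most [sinf] has
     [p a >= 1 / sinf]. *)
  rewrite mul1e; apply: (@le_trans _ _ (p a)%:E).
    by rewrite p_EFin lee_pV2// inE ?lar_ge0// (le_trans _ sinf1).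
  by rewrite lee_fin; apply: le_bigmax_seq.
- apply: ge_ereal_sup => _ [A /min_lar[a aA asinf] <-].
  exact: (bigmin_inf_seq +oo a).
Qed.
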